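(* Let $p\equiv 1\pmod 4$ be a prime, let $\zeta_p$ be a primitive $p$-th root of unity, and let $a,b\in\mathbb{Z}$ with $2\nmid a$ and $p=a^2+b^2$. Let $\triangle$ be a quadratic non-residue modulo $p$. Let $C_p$ be the $\frac{p-1}{2}\times\frac{p-1}{2}$ matrix $$C_p=\left(\frac{1-\zeta_p^{j^2k^2}}{1-\zeta_p^{j^2}}\right)_{1\le j,k\le (p-1)/2}$$ and let $T(\triangle,p)$ be the $\frac{p+1}{2}\times\frac{p+1}{2}$ matrix $$T(\triangle,p)=\left(\left(\frac{j^2+\triangle k^2}{p}\right)\right)_{0\le j,k\le (p-1)/2},$$ where $\left(\frac{\cdot}{p}\right)$ is the Legendre symbol. Then one may write $$\det[C_p]=\frac{\varepsilon_p^{h(p)}}{\sqrt{p}}\left(\alpha_p+\beta_p\sqrt{p}\right)\sqrt{\left(\frac{2}{p}\right)2p+2a\sqrt{p}}$$ with $\alpha_p,\beta_p\in\mathbb{Q}$. Meanwhile, for a suitable choice of the sign $\pm$, $$\pm 2^{\frac{p+1}{2}}\,b\,(\alpha_p^2-p\beta_p^2)=p^{\frac{p-1}{4}}\det[T(\triangle,p)].$$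
   Context: Here $h(p)$ and $\varepsilon_p>1$ denote the class number and the fundamental unit of the real quadratic field $\mathbb{Q}(\sqrt{p})$, respectively, and $\sqrt p>0$. The Legendre symbol satisfies $\left(\frac{0}{p}\right)=0$. The outer square root $\sqrt{\left(\frac{2}{p}\right)2p+2a\sqrt{p}}$ denotes a fixed complex square root (the radicand may be negative). *)

(* Defs.v *)
(* Everything takes place in algC, the field of algebraic complex
   numbers: it contains all the numbers involved (roots of unity, square roots,
   elements of number fields), and sqrtC x is the nonnegative root for x >= 0. *)
From HB Require Import structures.
From mathcomp Require Import all_boot all_order all_algebra all_field.

Set Implicit Arguments.
Unset Strict Implicit.
Unset Printing Implicit Defensive.

Import Order.TTheory GRing.Theory Num.Theory.
Local Open Scope ring_scope.

Definition square_mod (p : nat) (x : int) : bool :=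
  [exists y : 'I_p, ((y%:Z ^+ 2)%R == x %[mod p%:Z])%Z].

Definition legendre (x : int) (p : nat) : int :=
  if (p%:Z %| x)%Z then 0 else if square_mod p x then 1 else -1.

(* As 0 is a square, the non-residues are exactly the x with (x/p) = -1. *)
Definition quadratic_nonresidue (p : nat) (x : int) : Prop :=
  ~~ square_mod p x.

Definition in_Qsqrt (d : nat) (x : algC) : Prop :=
  exists r s : rat, x = ratr r + ratr s * sqrtC d%:R.

Definition in_OQsqrt (d : nat) (x : algC) : Prop :=
  in_Qsqrt d x /\ x \in Aint.

Definition OQsqrt_unit (d : nat) (u : algC) : Prop :=
  u != 0 /\ in_OQsqrt d u /\ in_OQsqrt d u^-1.

Definition fundamental_unit (d : nat) (eps : algC) : Prop :=
  [/\ OQsqrt_unit d eps, 1 < eps &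
      forall u : algC, OQsqrt_unit d u ->
        exists (s : bool) (n : int), u = (-1) ^+ s * eps ^ n].

Definition nonzero_ideal (d : nat) (I : algC -> Prop) : Prop :=
  [/\ forall x, I x -> in_OQsqrt d x,
      forall x y, I x -> I y -> I (x + y),
      forall c x, in_OQsqrt d c -> I x -> I (c * x) &
      exists2 x, I x & x != 0].

(* a I = b J for some nonzero a, b in the ring of integers *)
Definition ideal_equiv (d : nat) (I J : algC -> Prop) : Prop :=
  exists a b : algC,
    [/\ in_OQsqrt d a, a != 0, in_OQsqrt d b, b != 0 &
        forall x : algC,
          (exists2 y, I y & x = a * y) <-> (exists2 y, J y & x = b * y)].

(* c is a system of representatives of the ideal classes. *)
Definition class_number (d h : nat) : Prop :=
  exists c : 'I_h -> (algC -> Prop),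
    [/\ forall i, nonzero_ideal d (c i),
        forall i j, ideal_equiv d (c i) (c j) -> i = j &
        forall I, nonzero_ideal d I -> exists i, ideal_equiv d I (c i)].

(* Ordinals start at 0, whence the shift of both indices. *)
Definition Cmat (p : nat) (zeta : algC) : 'M[algC]_((p.-1)./2) :=
  \matrix_(j, k) ((1 - zeta ^+ (j.+1 ^ 2 * k.+1 ^ 2)%N) /
                  (1 - zeta ^+ (j.+1 ^ 2)%N)).

Definition Tmat (D : int) (p : nat) : 'M[int]_((p.+1)./2) :=
  \matrix_(j, k) legendre (j%:Z ^+ 2 + D * k%:Z ^+ 2) p.

(* Main.v *)
Require Import Defs.
From HB Require Import structures.
From mathcomp Require Import all_boot all_order all_algebra all_field.
From mathcomp Require Import all_fingroup.
From mathcomp Require Import ring zify.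

Set Implicit Arguments.
Unset Strict Implicit.
Unset Printing Implicit Defensive.

Import Order.TTheory GRing.Theory Num.Theory.
Local Open Scope ring_scope.

(** Write n = (p-1)/2, q = sqrt p, e(x) = zeta^x, and let C(zeta) be the matrix
    of the theorem.

    The factor eps^h lies in Q(q) and has norm 1 or -1, so alpha + beta q
    absorbs it, at the price of the sign that the statement leaves open.  Two
    facts remain: det C(zeta) lies in Q(q) w, and
    the norm of the quotient is given by det T.

    First fact.  An automorphism zeta |-> zeta^(y^2) permutes the rows of
    C(zeta), as j |-> y j on F_p^* / {1,-1}, and the sign of this permutation
    is (y/p) (sqr_perm_sign, by a Vandermonde determinant over F_p).  The
    quartic Gauss sums R_c = sum_x (x/p) e(c x^2) change by the same sign, so
    R_c det C(zeta) is fixed by all squares and lies in Q(q) (fixed_in_Qsqrt).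
    Moreover w is R_c up to sign, for c = 1 or a non-residue c = d.  Indeed a
    product of two such sums is computed by one substitution (quarticM):
      R_1^2 = 2 (2/p) p + g S,   R_d^2 = 2 (2/p) p - g S,   R_1 R_d = g S',
    with g = q or -q the quadratic Gauss sum and S, S' two integers.  Comparing
    (R_1 R_d)^2 with R_1^2 R_d^2 gives S^2 + S'^2 = 4 p, and the uniqueness of
    p = a^2 + b^2 with a odd forces S = 2 a up to sign (jacobsthal_sqr).

    Second fact.  Let M_c = (1 - e(c j^2 k^2)); up to the denominators, M_1 is
    C(zeta) and M_d is its conjugate.  The entries of M_1 M_d are sums over the
    nonzero squares, hence values of the quadratic Gauss sum, and
      M_1 M_d = (g / 2) (S0 + g J),   S0 = ((j^2 + d k^2)/p),  J all ones
    (expF_mxM).  The matrix T is S0 with a border, so that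
    det (S0 + g J) = det S0 + g det T, and det S0 = 0 since its columns have
    sum zero.  The denominators contribute the product p of all 1 - zeta^x.
    So det C(zeta) times its conjugate is an explicit multiple of det T; since
    w times its conjugate has square 4 p b^2, the square of the claimed
    equality follows, and with it the equality up to sign. *)

(** * Squares modulo p *)

Lemma big_two_images (R : Type) (idx : R) (op : Monoid.com_law idx)
    (I T : finType) (h1 h2 : I -> T) (P : pred T) (F : T -> R) :
  injective h1 -> injective h2 -> (forall i j, h1 i != h2 j) ->
  (forall x, P x = (x \in codom h1) || (x \in codom h2)) ->
  \big[op/idx]_(x | P x) F x
    = op (\big[op/idx]_i F (h1 i)) (\big[op/idx]_i F (h2 i)).
Proof.
move=> h1_inj h2_inj h12 PE.
pose h (u : I + I) := match u with inl i => h1 i | inr i => h2 i end.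
have h_inj : injective h.
  move=> [i|i] [j|j] /= E; first by rewrite (h1_inj _ _ E).
  - by case/eqP: (h12 i j).
  - by case/eqP: (h12 j i).
  by rewrite (h2_inj _ _ E).
rewrite (eq_bigl (mem (h @: setT))); last first.
  move=> x; rewrite PE; apply/idP/imsetP.
    by case/orP=> /codomP [i ->]; [exists (inl i) | exists (inr i)].
  by case=> -[i|i] _ -> /=; rewrite codom_f ?orbT.
rewrite big_imset /=; last by move=> u v _ _; apply: h_inj.
by rewrite (eq_bigl predT) ?big_sumType // => u; rewrite inE.
Qed.

Section Residues.

Variable p : nat.
Hypotheses (p_prime : prime p) (p_mod4 : (p = 1 %[mod 4])%N).
Let n := (p.-1)./2.
Implicit Types x y c d t : 'F_p.

(** 1, ..., (p-1)/2 represent the nonzero residues up to sign; the shift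
    matches the indices of the matrices. *)
Definition rep (k : 'I_(p.-1)./2) : 'F_p := k.+1%:R.

(** The Legendre symbol, on residue classes. *)
Definition chi x : int :=
  if x == 0 then 0 else if [exists y : 'F_p, y ^+ 2 == x] then 1 else -1.

Lemma p_half : p = n.*2.+1.
Proof. by rewrite /n; move: p_mod4 p_prime; rewrite -divn2; lia. Qed.

Lemma half_not_odd : ~~ odd n.
Proof. by rewrite /n; move: p_mod4; rewrite -divn2; lia. Qed.

Lemma halfp_gt0 : (0 < n)%N.
Proof. by have := prime_gt1 p_prime; have := p_half; lia. Qed.

Lemma natF_eq0 m : ((m%:R : 'F_p) == 0) = (p %| m)%N.
Proof. by rewrite -(dvdn_pcharf (pchar_Fp p_prime)). Qed.

Lemma two_neq0 : (2%:R : 'F_p) != 0.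
Proof.
rewrite natF_eq0 gtnNdvd //.
by have := p_half; have := halfp_gt0; lia.
Qed.

Lemma rep_neq0 k : rep k != 0.
Proof.
rewrite natF_eq0 gtnNdvd //.
by have := p_half; have := ltn_ord k; rewrite -/n; lia.
Qed.

Lemma repD_neq0 j k : rep j + rep k != 0.
Proof.
rewrite -natrD natF_eq0 gtnNdvd ?addSn //.
by have := p_half; have := ltn_ord k; have := ltn_ord j; rewrite -/n; lia.
Qed.

Lemma rep_inj : injective rep.
Proof.
move=> j k /(congr1 (@nat_of_ord _)); rewrite !val_Fp_nat // !modn_small.
- by move=> [E]; apply: val_inj.
- by have := p_half; have := ltn_ord k; rewrite -/n; lia.
- by have := p_half; have := ltn_ord j; rewrite -/n; lia.
Qed.

Lemma rep_sqr_inj : injective (fun k => rep k ^+ 2).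
Proof.
move=> j k /eqP; rewrite eqf_sqr => /orP [] /eqP; first exact: rep_inj.
by move/eqP; rewrite -addr_eq0 (negPf (repD_neq0 j k)).
Qed.

Lemma rep_cover x : x != 0 -> exists k, x = rep k \/ x = - rep k.
Proof.
move=> x0; have xp : (x < p)%N by rewrite -[X in (_ < X)%N](Fp_cast p_prime).
have xE : x = (x : nat)%:R by rewrite natr_Zp.
have x_gt0 : (0 < x)%N by rewrite lt0n; apply: contraNN x0 => /eqP xz; rewrite xE xz.
have := p_half => pE.
case: (leqP x n) => xn.
  have kn : (x.-1 < n)%N by lia.
  exists (Ordinal kn); left; rewrite /rep /= prednK //.
have kn : ((p - x).-1 < n)%N by lia.
exists (Ordinal kn); right; rewrite /rep /= prednK ?subn_gt0 //.
by rewrite natrB 1?ltnW // pchar_Fp_0 // sub0r opprK.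
Qed.

Lemma rep_sqr_cover x : x != 0 -> exists k, x ^+ 2 = rep k ^+ 2.
Proof. by move=> /rep_cover [k [] ->]; exists k; rewrite ?sqrrN. Qed.

Lemma chi_sqr x : x != 0 -> chi (x ^+ 2) = 1.
Proof.
move=> x0; rewrite /chi sqrf_eq0 (negPf x0) ifT //.
by apply/existsP; exists x.
Qed.

Lemma chi1P x : reflect (exists2 y, y != 0 & x = y ^+ 2) (chi x == 1).
Proof.
apply: (iffP idP) => [|[y y0 ->]]; last by rewrite chi_sqr.
rewrite /chi; case: (eqVneq x 0) => // x0; case: ifP => // /existsP [y /eqP yx] _.
by exists y => //; apply: contra x0 => /eqP y0; rewrite -yx y0 expr0n.
Qed.

Lemma chi0 : chi 0 = 0. Proof. by rewrite /chi eqxx. Qed.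

Lemma chi_cases x : [\/ x = 0, chi x = 1 | chi x = -1].
Proof.
case: (eqVneq x 0) => [->|x0]; first exact: Or31.
by rewrite /chi (negPf x0); case: ifP => _; [apply: Or32 | apply: Or33].
Qed.

Lemma fermat x : x != 0 -> x ^+ n.*2 = 1.
Proof.
move=> x0; apply: (mulfI x0); rewrite -exprS -p_half mulr1.
by have := expf_card x; rewrite card_Fp.
Qed.

(** Euler's criterion: a non-residue x with x^n = 1 would be one root too many
    for X^n - 1, which already has the n nonzero squares as roots. *)
Lemma chi_euler x : (chi x)%:~R = x ^+ n.
Proof.
case: (eqVneq x 0) => [->|x0]; first by rewrite chi0 expr0n gtn_eqF ?halfp_gt0.
case: (chi_cases x) => [xz|c1|cN1]; first by rewrite xz eqxx in x0.
  rewrite c1; move/eqP/chi1P: c1 => [y y0 ->].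
  by rewrite -exprM mul2n fermat.
rewrite cN1; have : (x ^+ n) ^+ 2 == 1 by rewrite -exprM muln2 fermat.
rewrite sqrf_eq1 => /orP [/eqP xn|/eqP ->]; last by [].
pose rs := x :: [seq rep k ^+ 2 | k <- enum 'I_(p.-1)./2].
have nz : 'X^n - 1%:P != 0 :> {poly 'F_p}.
  by rewrite -size_poly_gt0 size_XnsubC ?halfp_gt0.
have rootE y : root ('X^n - 1%:P) y = (y ^+ n == 1).
  by rewrite rootE !hornerE subr_eq0.
have all_rs : all (root ('X^n - 1%:P)) rs.
  rewrite /= rootE xn eqxx; apply/allP => _ /mapP [k _ ->].
  by rewrite rootE -exprM mul2n fermat ?rep_neq0.
have uniq_rs : uniq rs.
  rewrite /= map_inj_uniq ?enum_uniq ?andbT; last exact: rep_sqr_inj.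
  apply/negP => /mapP [k _ xk]; move: cN1.
  by rewrite xk chi_sqr ?rep_neq0.
have := max_poly_roots nz all_rs uniq_rs.
by rewrite size_XnsubC ?halfp_gt0 //= size_map size_enum_ord ltnn.
Qed.

(** By Euler's criterion both sides agree modulo p; as they are 0, 1 or -1 and
    p is odd, they agree as integers. *)
Lemma chiM x y : chi (x * y) = chi x * chi y.
Proof.
have E : ((chi (x * y))%:~R : 'F_p) = (chi x * chi y)%:~R.
  by rewrite intrM !chi_euler exprMn.
have ne : (1 : 'F_p) != -1 by rewrite -subr_eq0 opprK -mulr2n two_neq0.
case: (eqVneq x 0) => [->|x0]; first by rewrite mul0r chi0 mul0r.
case: (eqVneq y 0) => [->|y0]; first by rewrite mulr0 chi0 mulr0.
move: E; case: (chi_cases (x * y)) => [/eqP| ->| ->].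
- by rewrite mulf_eq0 (negPf x0) (negPf y0).
- case: (chi_cases x) => [xz| ->| ->]; first by rewrite xz eqxx in x0.
    case: (chi_cases y) => [yz| ->| ->] //; first by rewrite yz eqxx in y0.
    by move/eqP; rewrite (negPf ne).
  case: (chi_cases y) => [yz| ->| ->] //; first by rewrite yz eqxx in y0.
  by move/eqP; rewrite (negPf ne).
case: (chi_cases x) => [xz| ->| ->]; first by rewrite xz eqxx in x0.
  case: (chi_cases y) => [yz| ->| ->] //; first by rewrite yz eqxx in y0.
  by move/eqP; rewrite eq_sym (negPf ne).
case: (chi_cases y) => [yz| ->| ->] //; first by rewrite yz eqxx in y0.
by move/eqP; rewrite eq_sym (negPf ne).
Qed.

Lemma chi_eq0 x : (chi x == 0) = (x == 0).
Proof. by rewrite /chi; case: ifP => // _; case: ifP. Qed.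

Lemma chiN1 : chi (-1) = 1.
Proof.
apply/eqP/negPn/negP; case: (chi_cases (-1)) => [/eqP|->//|c].
  by rewrite oppr_eq0 oner_eq0.
have := chi_euler (-1); rewrite c -signr_odd (negPf half_not_odd) expr0.
by move/eqP; rewrite -subr_eq0 -opprD oppr_eq0 -mulr2n (negPf two_neq0).
Qed.

Lemma chiN x : chi (- x) = chi x.
Proof. by rewrite -mulN1r chiM chiN1 mul1r. Qed.

Lemma chi_sqrl x y : x != 0 -> chi (x ^+ 2 * y) = chi y.
Proof. by move=> x0; rewrite chiM chi_sqr // mul1r. Qed.

Lemma sqrtN1_exists : exists i : 'F_p, i ^+ 2 = -1.
Proof. by have /chi1P [i _ ->] := introT eqP chiN1; exists i. Qed.

(** If i^2 = -1 then (1 + i)^2 = 2 i, so 2 and i have the same character. *)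
Lemma chi2_sqrtN1 i : i ^+ 2 = -1 -> chi 2%:R = chi i.
Proof.
move=> i2.
have i0 : i != 0 by rewrite -sqrf_eq0 i2 oppr_eq0 oner_eq0.
have i1 : 1 + i != 0.
  apply/eqP => /eqP; rewrite addrC addr_eq0 => /eqP ii.
  move: i2; rewrite ii sqrrN expr1n => /eqP.
  by rewrite -subr_eq0 opprK -mulr2n (negPf two_neq0).
have := chi_sqr i1; rewrite (_ : (1 + i) ^+ 2 = 2%:R * i); last first.
  by rewrite sqrrD i2; ring.
rewrite chiM; case: (chi_cases i) => [/eqP|->|->].
- by rewrite (negPf i0).
- by rewrite mulr1.
- by rewrite mulrN1 => /eqP; rewrite eqr_oppLR => /eqP.
Qed.

Lemma sum_nonzero (R : nmodType) (f : 'F_p -> R) :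
  \sum_(x | x != 0) f x = \sum_k f (rep k) + \sum_k f (- rep k).
Proof.
apply: big_two_images => [||j k|x].
- exact: rep_inj.
- by move=> j k /oppr_inj /rep_inj.
- by rewrite -subr_eq0 opprK repD_neq0.
apply/idP/orP => [/rep_cover [k [] ->]|].
- by left; apply: codom_f.
- by right; apply: (codom_f (fun k => - rep k)).
by case=> /codomP [k ->]; rewrite ?oppr_eq0 rep_neq0.
Qed.

Lemma sum_nonzero_even (R : nmodType) (f : 'F_p -> R) :
  (forall x, f (- x) = f x) ->
  \sum_(x | x != 0) f x = (\sum_k f (rep k)) *+ 2.
Proof.
by move=> fN; rewrite sum_nonzero mulr2n; congr (_ + _); apply: eq_bigr.
Qed.

(** The nonzero residues are the squares and their multiples by a fixed
    non-residue d.  This is used for sums and for products. *)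
Lemma big_nonzero_classes (R : Type) (idx : R) (op : Monoid.com_law idx)
    d (f : 'F_p -> R) : chi d = -1 ->
  \big[op/idx]_(x | x != 0) f x
    = op (\big[op/idx]_k f (rep k ^+ 2)) (\big[op/idx]_k f (d * rep k ^+ 2)).
Proof.
move=> chid; have d0 : d != 0 by rewrite -chi_eq0 chid.
apply: big_two_images => [||j k|x].
- exact: rep_sqr_inj.
- by move=> j k /(mulfI d0) /rep_sqr_inj.
- apply/eqP => /(congr1 chi).
  by rewrite (chiM d) !(chi_sqr (rep_neq0 _)) chid.
apply/idP/orP => [x0|].
  case: (chi_cases x) => [/eqP|/eqP/chi1P|chix]; first by rewrite (negPf x0).
    case=> y y0 ->; have [k ->] := rep_sqr_cover y0.
    by left; apply: (codom_f (fun k => rep k ^+ 2)).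
  have /eqP /chi1P : chi (x / d) = 1.
    have := chiM (x / d) d; rewrite divfK // chix chid mulrN1 => /eqP.
    by rewrite eqr_opp => /eqP.
  case=> y y0 /(congr1 ( *%R^~ d)); rewrite divfK // => ->.
  have [k ->] := rep_sqr_cover y0; right; rewrite mulrC.
  exact: (codom_f (fun k => d * rep k ^+ 2)).
by case=> /codomP [k ->]; rewrite !mulf_neq0 ?rep_neq0.
Qed.

Lemma big_rep_sqr (R : Type) (idx : R) (op : Monoid.com_law idx)
    (f : 'F_p -> R) :
  \big[op/idx]_k f (rep k ^+ 2) = \big[op/idx]_(x | chi x == 1) f x.
Proof.
rewrite (eq_bigl (mem ((fun k => rep k ^+ 2) @: setT))).
  rewrite big_imset /=; last by move=> j k _ _; apply: rep_sqr_inj.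
  by apply: eq_bigl => k; rewrite inE.
move=> x; apply/chi1P/imsetP => [[y /rep_sqr_cover [k yk] ->]|[k _ ->]].
  by exists k.
by exists (rep k) => //; apply: rep_neq0.
Qed.

Lemma sum_chi d : chi d = -1 -> \sum_x chi x = 0.
Proof.
move=> chid; have d0 : d != 0 by rewrite -chi_eq0 chid.
have : \sum_x chi x = - \sum_x chi x.
  rewrite {1}(reindex_inj (mulfI d0)) /= -mulN1r -chid mulr_sumr.
  by apply: eq_bigr => x _; rewrite chiM.
by lia.
Qed.

End Residues.

(** * Gauss sums *)

Section ExponentialSums.

Variable p : nat.
Hypotheses (p_prime : prime p) (p_mod4 : (p = 1 %[mod 4])%N).
Variable zeta : algC.
Hypothesis zeta_prim : p.-primitive_root zeta.
Variable d : 'F_p.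
Hypothesis chid : chi d = -1.
Let n := (p.-1)./2.
Implicit Types (x y c t : 'F_p).

Definition expF x : algC := zeta ^+ x.
Local Notation e := expF.

Lemma expF_nat m : e m%:R = zeta ^+ m.
Proof. by rewrite /expF val_Fp_nat // (prim_expr_mod zeta_prim). Qed.

Lemma expFD x y : e (x + y) = e x * e y.
Proof. by rewrite -[x]natr_Zp -[y]natr_Zp -natrD !expF_nat exprD. Qed.

Lemma expF0 : e 0 = 1.
Proof. by rewrite (expF_nat 0) expr0. Qed.

Lemma expFMn c m : e (c * m%:R) = e c ^+ m.
Proof. by rewrite -[c]natr_Zp -natrM !expF_nat exprM. Qed.

Lemma expF_eq1 x : (e x == 1) = (x == 0).
Proof.
by rewrite -[x]natr_Zp expF_nat -(prim_order_dvd zeta_prim) natF_eq0.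
Qed.

(** Translating x by 1 multiplies the sum by e c, which is not 1 if c <> 0. *)
Lemma sum_expF c : \sum_x e (c * x) = if c == 0 then p%:R else 0.
Proof.
case: eqVneq => [->|c0].
  under eq_bigr do rewrite mul0r expF0.
  by rewrite sumr_const card_Fp.
have : \sum_x e (c * x) = e c * \sum_x e (c * x).
  rewrite {1}(reindex_inj (addrI 1)) mulr_sumr; apply: eq_bigr => x _ /=.
  by rewrite mulrDr mulr1 expFD.
move/eqP; rewrite -subr_eq0 -{1}[X in X - _]mul1r -mulrBl mulf_eq0 subr_eq0.
by rewrite eq_sym expF_eq1 (negPf c0) => /eqP.
Qed.

Definition gauss_sum : algC := \sum_x e (x ^+ 2).
Local Notation g := gauss_sum.

Lemma sum_nonzeroE (f : 'F_p -> algC) :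
  \sum_(x | x != 0) f x = \sum_x f x - f 0.
Proof. by rewrite [in RHS](bigD1 0) //= addrAC subrr add0r. Qed.

(** The sum depends only on the quadratic class of c, and the sums for the two
    classes add up to -1, the sum of all nontrivial powers of zeta. *)
Lemma half_sum_expF c : c != 0 ->
  \sum_k e (c * rep k ^+ 2) = ((chi c)%:~R * g - 1) / 2%:R.
Proof.
have gE : g = 1 + (\sum_k e (rep k ^+ 2)) *+ 2.
  rewrite -(@sum_nonzero_even _ p_prime p_mod4 _ (fun x => e (x ^+ 2))).
    by rewrite sum_nonzeroE expr0n expF0 addrCA subrr addr0.
  by move=> x; rewrite sqrrN.
have NE : \sum_k e (rep k ^+ 2) + \sum_k e (d * rep k ^+ 2) = -1.
  rewrite -(@big_nonzero_classes _ p_prime p_mod4 _ _ _ d e chid).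
  rewrite sum_nonzeroE expF0; have := sum_expF 1.
  by rewrite oner_eq0; under eq_bigr do rewrite mul1r; move=> ->; rewrite sub0r.
have sqE (f : 'F_p -> algC) y : y != 0 ->
    \sum_k f (y ^+ 2 * rep k ^+ 2) = \sum_k f (rep k ^+ 2).
  move=> y0; have y20 : y ^+ 2 != 0 by rewrite sqrf_eq0.
  rewrite (@big_rep_sqr _ p_prime p_mod4 _ _ _ (fun x => f (y ^+ 2 * x))).
  rewrite (@big_rep_sqr _ p_prime p_mod4 _ _ _ f) [RHS](reindex_inj (mulfI y20)) /=.
  by apply: eq_bigl => x; rewrite chi_sqrl.
move=> c0; case: (chi_cases c) => [/eqP|/eqP/chi1P [y y0 ->]|cc].
- by rewrite (negPf c0).
- by rewrite (sqE e) // chi_sqr // gE; field.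
have d0 : d != 0 by rewrite -chi_eq0 chid.
have /eqP /chi1P : chi (c / d) = 1.
  have := chiM p_prime p_mod4 (c / d) d; rewrite divfK // cc chid mulrN1 => /eqP.
  by rewrite eqr_opp => /eqP.
move=> [y y0 /(congr1 ( *%R^~ d)) /=]; rewrite divfK // => cE.
rewrite cE chiM // chi_sqr // mul1r chid.
under eq_bigr do rewrite -mulrA [d * _]mulrC mulrA mulrC.
rewrite (sqE (fun x => e (d * x))) //.
have /eqP := NE; rewrite addrC -subr_eq0 opprK -addrA addr_eq0 => /eqP ->.
by rewrite gE; field.
Qed.

Lemma sum_expF_sqr c :
  \sum_(x | x != 0) e (x ^+ 2 * c)
    = (chi c)%:~R * g - 1 + (if c == 0 then p%:R else 0).
Proof.
case: (eqVneq c 0) => [->|c0].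
  rewrite chi0 mul0r sub0r; under eq_bigr do rewrite mulr0 expF0.
  rewrite (sum_nonzeroE (fun=> 1)) sumr_const card_Fp //.
  by rewrite addrC.
rewrite (@sum_nonzero_even _ p_prime p_mod4 _ (fun x => e (x ^+ 2 * c))).
  by under eq_bigr do rewrite mulrC; rewrite half_sum_expF // addr0; field.
by move=> x; rewrite sqrrN.
Qed.

(** As -1 is a square, g is also the sum of the e(- x^2).  In the product of
    both sums put y + x for the second variable: the summation over x is then
    linear in the exponent and leaves only y = 0. *)
Lemma gauss_sqr : g ^+ 2 = p%:R.
Proof.
have [i i2] := sqrtN1_exists p_prime p_mod4.
have i0 : i != 0 by rewrite -sqrf_eq0 i2 oppr_eq0 oner_eq0.
have gN : g = \sum_x e (- x ^+ 2).
  rewrite /gauss_sum (reindex_inj (mulfI i0)) /=.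
  by apply: eq_bigr => x _; rewrite exprMn i2 mulN1r.
rewrite expr2 {2}gN /gauss_sum mulr_suml.
transitivity (\sum_x \sum_y e (- y ^+ 2) * e (- 2%:R * y * x)).
  apply: eq_bigr => x _; rewrite mulr_sumr (reindex_inj (addrI x)) /=.
  by apply: eq_bigr => y _; rewrite -!expFD; congr e; ring.
have inner y : \sum_x e (- y ^+ 2) * e (- 2%:R * y * x)
               = if y == 0 then p%:R else 0.
  rewrite -mulr_sumr sum_expF mulf_eq0 oppr_eq0 (negPf (two_neq0 _ _)) //=.
  by case: eqP => [->|_]; rewrite ?mulr0 // expr0n oppr0 expF0 mul1r.
rewrite exchange_big /=; under eq_bigr do rewrite inner.
by rewrite -big_mkcond big_pred1_eq.
Qed.

(** For c = 1 this is the Gauss sum of a quartic character plus its conjugate: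
    (x/p) tells whether x^2 is a fourth power. *)
Definition quartic_sum c : algC := \sum_x (chi x)%:~R * e (c * x ^+ 2).

Definition jacobsthal c c' : int := \sum_t chi t * chi (c + c' * t ^+ 2).

(** Substituting y = x t in the double sum makes the character depend on t
    alone, and leaves for each t a sum over nonzero x of e(x^2 z) with
    z = c + c' t^2, which is a quadratic Gauss sum. *)
Lemma quarticM c c' :
  quartic_sum c * quartic_sum c' = g * (jacobsthal c c')%:~R
    + p%:R * (\sum_(t | c + c' * t ^+ 2 == 0) chi t)%:~R.
Proof.
have chiF (f : 'F_p -> algC) :
    \sum_x (chi x)%:~R * f x = \sum_(x | x != 0) (chi x)%:~R * f x :> algC.
  by rewrite (sum_nonzeroE (fun x => (chi x)%:~R * f x)) chi0 mul0r subr0.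
transitivity (\sum_t (chi t)%:~R *
    \sum_(x | x != 0) e (x ^+ 2 * (c + c' * t ^+ 2))).
  rewrite /quartic_sum chiF mulr_suml; under [RHS]eq_bigr do rewrite mulr_sumr.
  rewrite [RHS]exchange_big /=; apply: eq_bigr => x x0.
  rewrite mulr_sumr (reindex_inj (mulfI x0)) /=; apply: eq_bigr => t _.
  rewrite chiM // intrM.
  have chix2 : (chi x)%:~R * (chi x)%:~R = 1 :> algC.
    by rewrite -intrM -chiM // -expr2 chi_sqr.
  rewrite mulrACA [_ * (_ * (chi t)%:~R)]mulrA chix2 mul1r -expFD.
  by congr (_ * e _); ring.
under eq_bigr do rewrite sum_expF_sqr mulrDr mulrBr mulr1.
rewrite big_split /= sumrB -rmorph_sum /= (sum_chi p_prime p_mod4 chid) subr0.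
congr (_ + _).
  rewrite /jacobsthal rmorph_sum mulr_sumr /=; apply: eq_bigr => t _.
  by rewrite intrM mulrA mulrC.
rewrite [in RHS]big_mkcond rmorph_sum mulr_sumr /=; apply: eq_bigr => t _.
by case: ifP => _; rewrite ?mulr0 // mulrC.
Qed.

(** -d is a non-residue, so the form x^2 + d t^2 is anisotropic. *)
Lemma add_nonsqr_neq0 x t : (x != 0) || (t != 0) -> x ^+ 2 + d * t ^+ 2 != 0.
Proof.
move=> xt; apply/eqP => /eqP; rewrite addr_eq0 => /eqP E.
have t0 : t != 0.
  apply: contraTN xt => /eqP t0; move: E; rewrite t0 expr0n mulr0 oppr0.
  by move/eqP; rewrite sqrf_eq0 => ->; rewrite eqxx.
have x0 : x != 0.
  rewrite -sqrf_eq0 E oppr_eq0 mulf_neq0 ?sqrf_eq0 //.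
  by rewrite -chi_eq0 chid.
move/(congr1 (@chi p)): E; rewrite chi_sqr // chiN // mulrC chi_sqrl //.
by rewrite chid.
Qed.

Lemma sum_chi_sqrtN1 :
  \sum_(t : 'F_p | t ^+ 2 == -1) chi t = chi (2%:R : 'F_p) *+ 2.
Proof.
have [i i2] := sqrtN1_exists p_prime p_mod4.
have i0 : i != 0 by rewrite -sqrf_eq0 i2 oppr_eq0 oner_eq0.
have iN : - i != i.
  by rewrite eq_sym -addr_eq0 -mulr2n -mulr_natr mulf_neq0 ?two_neq0.
rewrite (bigD1 i) ?i2 //= (bigD1 (- i)) /=; last by rewrite sqrrN i2 eqxx.
rewrite big1 => [|t /andP[/andP[]]].
  by rewrite addr0 chiN // (chi2_sqrtN1 p_prime p_mod4 i2) mulr2n.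
by rewrite -i2 eqf_sqr => /orP [] /eqP ->; rewrite eqxx.
Qed.

Lemma quartic1_sqr :
  quartic_sum 1 ^+ 2 = g * (jacobsthal 1 1)%:~R + p%:R * (chi (2%:R : 'F_p) *+ 2)%:~R.
Proof.
rewrite expr2 quarticM -sum_chi_sqrtN1; congr (_ + _).
congr (_ * _%:~R); apply: eq_bigl => t.
by rewrite mul1r addrC addr_eq0.
Qed.

Lemma quarticd_sqr :
  quartic_sum d ^+ 2
    = - (g * (jacobsthal 1 1)%:~R) + p%:R * (chi (2%:R : 'F_p) *+ 2)%:~R.
Proof.
have d0 : d != 0 by rewrite -chi_eq0 chid.
rewrite expr2 quarticM -sum_chi_sqrtN1; congr (_ + _).
  rewrite -mulrN -rmorphN /=; congr (_ * _%:~R).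
  rewrite /jacobsthal -sumrN; apply: eq_bigr => t _.
  rewrite -[X in X + _]mulr1 -mulrDr chiM // chid mul1r.
  by rewrite mulN1r mulrN.
congr (_ * _%:~R); apply: eq_bigl => t.
by rewrite -[X in X + _]mulr1 -mulrDr mulf_eq0 (negPf d0) /= addrC addr_eq0.
Qed.

Lemma quartic1_mul_quarticd : quartic_sum 1 * quartic_sum d = g * (jacobsthal 1 d)%:~R.
Proof.
rewrite quarticM big_pred0 ?mulr0 ?addr0 // => t.
apply/negbTE; rewrite -(expr1n _ 2); apply: add_nonsqr_neq0.
by rewrite oner_eq0.
Qed.

(** Jacobsthal's representation of p as a sum of two squares, read off from
    (R_1 R_d)^2 = R_1^2 R_d^2 for the quartic Gauss sums R_c. *)
Lemma jacobsthal_two_squares : jacobsthal 1 1 ^+ 2 + jacobsthal 1 d ^+ 2 = 4 * p%:Z.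
Proof.
have pg : p%:R != 0 :> algC by rewrite pnatr_eq0 -lt0n prime_gt0.
have c2 : (chi (2%:R : 'F_p))%:~R ^+ 2 = 1 :> algC.
  case: (chi_cases (2%:R : 'F_p)) => [/eqP|->|->]; last 2 first.
  - by rewrite expr1n.
  - by rewrite sqrrN expr1n.
  by rewrite (negPf (two_neq0 p_prime p_mod4)).
have E : (g * (jacobsthal 1 d)%:~R) ^+ 2 = quartic_sum 1 ^+ 2 * quartic_sum d ^+ 2.
  by rewrite -exprMn quartic1_mul_quarticd.
move: E; rewrite quartic1_sqr quarticd_sqr => E.
apply: (@intr_inj algC); apply: (mulfI pg).
rewrite rmorphD !rmorphXn rmorphM /=.
move: E; rewrite rmorphMn /= exprMn gauss_sqr => E.
rewrite mulrDr {}E.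
have := gauss_sqr; move: c2.
set G := g; set c := _%:~R; set J := _%:~R => c2 G2.
rewrite (_ : (_ + _) * _ = - (G ^+ 2 * J ^+ 2) + 4 * p%:R ^+ 2 * c ^+ 2).
  by rewrite G2 c2 -[p%:~R]pmulrn; ring.
by ring.
Qed.

Lemma jacobsthal_half c c' :
  jacobsthal c c' = (\sum_k chi (rep k : 'F_p) * chi (c + c' * rep k ^+ 2)) *+ 2.
Proof.
rewrite /jacobsthal (bigD1 0) //= chi0 mul0r add0r.
rewrite (@sum_nonzero_even _ p_prime p_mod4 _
  (fun t => chi t * chi (c + c' * t ^+ 2))) //.
by move=> x; rewrite chiN // sqrrN.
Qed.

End ExponentialSums.

(** * The product of the two conjugate matrices *)

(** Both sides are the determinant of A bordered by the row (1, -c, ..., -c)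
    and the column (1, ..., 1): a row operation clears the column below the
    corner, and linearity in the first row splits the corner from the rest. *)
Lemma det_add_const (R : comNzRingType) m (A : 'M[R]_m) (c : R) :
  \det (A + const_mx c)
    = \det A + c * \det (block_mx (0 : 'M_1) (const_mx (-1)) (const_mx 1) A).
Proof.
pose B := block_mx (1%:M : 'M_1) (const_mx (- c)) (const_mx 1) A.
have -> : \det (A + const_mx c) = \det B.
  have -> : B = block_mx 1%:M 0 (const_mx 1) 1%:M
                *m block_mx 1%:M (const_mx (- c)) 0 (A + const_mx c).
    rewrite mulmx_block !mul1mx !mul0mx !mulmx1 !addr0 ; congr block_mx.
    apply/matrixP => i j; rewrite !mxE big_ord1 !mxE.
    by ring.
  by rewrite det_mulmx det_lblock det_ublock !det1 !mul1r.
rewrite (@determinant_multilinear _ _ _ (block_mx 1%:M 0 (const_mx 1) A)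
  (block_mx (0 : 'M_1) (const_mx (-1)) (const_mx 1) A) 0 1 c).
- by rewrite det_lblock det1 !mul1r.
- apply/rowP => j; rewrite !mxE; case: splitP => // i _; rewrite !mxE.
  by case: splitP => k _; rewrite !mxE; ring.
- apply/matrixP => i j; rewrite !mxE; case: splitP => // k.
  by rewrite ord1.
apply/matrixP => i j; rewrite !mxE; case: splitP => // k.
by rewrite ord1.
Qed.

Lemma det_cast (R : comNzRingType) m m' (E : m = m') (A : 'M[R]_m) (B : 'M[R]_m') :
  (forall i j, A i j = B (cast_ord E i) (cast_ord E j)) -> \det A = \det B.
Proof.
case: m' / E B => B AB; congr (\det _); apply/matrixP => i j.
by rewrite AB !cast_ord_id.
Qed.

Section Determinants.

Variable p : nat.
Hypotheses (p_prime : prime p) (p_mod4 : (p = 1 %[mod 4])%N).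
Variable zeta : algC.
Hypothesis zeta_prim : p.-primitive_root zeta.
Variable D : int.
Hypothesis D_nonres : quadratic_nonresidue p D.
Let n := (p.-1)./2.
Let d : 'F_p := D%:~R.
Local Notation e := (expF zeta).
Local Notation g := (gauss_sum p zeta).

Lemma intrF_eq0 (x : int) : ((x%:~R : 'F_p) == 0) = (p%:Z %| x)%Z.
Proof.
rewrite dvdzE /=; case: (intP x) => [|m|m]; first by rewrite eqxx dvdn0.
  by rewrite -pmulrn natF_eq0.
by rewrite rmorphN /= oppr_eq0 -pmulrn natF_eq0 // abszN.
Qed.

Lemma square_modE x : square_mod p x = [exists y : 'F_p, y ^+ 2 == x%:~R].
Proof.
have E (m : nat) : ((m%:Z ^+ 2)%R == x %[mod p%:Z])%Z = ((m%:R : 'F_p) ^+ 2 == x%:~R).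
  by rewrite eqz_mod_dvd -intrF_eq0 rmorphB rmorphXn /= subr_eq0 -pmulrn.
apply/existsP/existsP => [[y yx]|[y yx]].
  by exists (nat_of_ord y)%:R; rewrite -E.
have yp : (y < p)%N by rewrite -[X in (_ < X)%N](Fp_cast p_prime).
by exists (Ordinal yp); rewrite E /= natr_Zp.
Qed.

Lemma legendreE x : legendre x p = chi (x%:~R : 'F_p).
Proof. by rewrite /legendre /chi intrF_eq0 square_modE. Qed.

Lemma chi_nonresidue : chi d = -1.
Proof.
move: D_nonres; rewrite /quadratic_nonresidue square_modE /chi /d => nsq.
rewrite (negPf nsq) ifF //; apply: contraNF nsq => /eqP ->.
by apply/existsP; exists 0; rewrite expr0n.
Qed.

Definition legendre_mx : 'M[algC]_((p.-1)./2) :=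
  \matrix_(j, k) (chi (rep j ^+ 2 + d * rep k ^+ 2 : 'F_p))%:~R.

Definition expF_mx (c : 'F_p) : 'M[algC]_((p.-1)./2) :=
  \matrix_(j, k) (1 - e (c * (rep j ^+ 2 * rep k ^+ 2))).

Lemma halfC : (p.-1)./2%:R = (p%:R - 1) / 2%:R :> algC.
Proof.
rewrite [in RHS](p_half p_prime p_mod4) -addn1 natrD addrK -muln2 natrM.
by rewrite mulfK ?pnatr_eq0.
Qed.

(** Expanding the product of two entries gives four half sums of e; the two
    linear ones have opposite signs of g, since d is a non-residue. *)
Lemma expF_mxM :
  expF_mx 1 *m expF_mx d = (g / 2%:R) *: (legendre_mx + const_mx g).
Proof.
have d0 : d != 0 by rewrite -chi_eq0 chi_nonresidue.
have r0 (j : 'I_n) : rep j ^+ 2 != 0 :> 'F_p by rewrite sqrf_eq0 rep_neq0.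
apply/matrixP => j l; rewrite !mxE.
transitivity (\sum_(k : 'I_n) (1 - e (rep j ^+ 2 * rep k ^+ 2)
   - e (d * rep l ^+ 2 * rep k ^+ 2)
   + e ((rep j ^+ 2 + d * rep l ^+ 2) * rep k ^+ 2))).
  apply: eq_bigr => k _; rewrite !mxE mul1r.
  rewrite [(rep j ^+ 2 + _) * _]mulrDl (expFD p_prime zeta_prim).
  rewrite [rep k ^+ 2 * rep l ^+ 2]mulrC [d * (_ * _)]mulrA.
  by ring.
rewrite big_split /= !sumrB.
rewrite !(half_sum_expF p_prime p_mod4 zeta_prim chi_nonresidue) //; last 2 first.
- by apply: (add_nonsqr_neq0 p_prime p_mod4 chi_nonresidue); rewrite rep_neq0.
- by rewrite mulf_neq0.
rewrite sumr_const card_ord halfC chiM // chi_nonresidue !(chi_sqr (rep_neq0 _ _ _)) //.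
rewrite mulr1 -(gauss_sqr p_prime p_mod4 zeta_prim).
by rewrite rmorphN1; field.
Qed.

(** Up to g and a constant, an entry of this column is a sum over i of
    e(j^2 i^2) e(d k^2 i^2); summed over j first, the factors separate, with
    product (g - 1)/2 (-g - 1)/2 = (1 - p)/4. *)
Lemma legendre_mx_sum (k : 'I_n) : \sum_(j : 'I_n) legendre_mx j k = 0.
Proof.
have d0 : d != 0 by rewrite -chi_eq0 chi_nonresidue.
have r0 (j : 'I_n) : rep j ^+ 2 != 0 :> 'F_p by rewrite sqrf_eq0 rep_neq0.
have g0 : g != 0.
  by rewrite -sqrf_eq0 gauss_sqr // pnatr_eq0 -lt0n prime_gt0.
have gH := half_sum_expF p_prime p_mod4 zeta_prim chi_nonresidue.
have E : \sum_(i : 'I_n) \sum_(j : 'I_n) e (rep j ^+ 2 * rep i ^+ 2)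
      * e (d * rep k ^+ 2 * rep i ^+ 2)
    = \sum_(j : 'I_n) (g * legendre_mx j k - 1) / 2%:R.
  rewrite exchange_big /=; apply: eq_bigr => j _.
  rewrite mxE [g * _]mulrC -gH; last first.
    by apply: (add_nonsqr_neq0 p_prime p_mod4 chi_nonresidue); rewrite rep_neq0.
  by apply: eq_bigr => i _; rewrite mulrDl expFD.
have : \sum_(i : 'I_n) \sum_(j : 'I_n) e (rep j ^+ 2 * rep i ^+ 2)
      * e (d * rep k ^+ 2 * rep i ^+ 2) = (1 - p%:R) / 4%:R.
  under eq_bigr => i _.
    rewrite -mulr_suml; under eq_bigr do rewrite mulrC.
    rewrite gH // chi_sqr ?rep_neq0 //; over.
  rewrite -mulr_sumr (gH _ (mulf_neq0 d0 (r0 k))) chiM // chi_nonresidue.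
  rewrite chi_sqr ?rep_neq0 // mulr1.
  by rewrite -(gauss_sqr p_prime p_mod4 zeta_prim) rmorphN1; field.
rewrite E -mulr_suml sumrB -mulr_sumr sumr_const card_ord halfC => sE.
apply: (mulfI g0); rewrite mulr0.
move: sE; set X := g * _ => sE.
have -> : X = 2%:R * ((X - (p%:R - 1) / 2%:R) / 2%:R) + (p%:R - 1) / 2%:R by field.
by rewrite sE; field.
Qed.

Lemma det_legendre_mx : \det legendre_mx = 0.
Proof.
apply/eqP/det0P; exists (const_mx 1).
  have n0 : (0 < (p.-1)./2)%N := halfp_gt0 p_prime p_mod4.
  apply/eqP => /rowP /(_ (Ordinal n0)); rewrite !mxE => /eqP.
  by rewrite oner_eq0.
apply/rowP => k; rewrite !mxE -[RHS](legendre_mx_sum k).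
by apply: eq_bigr => j _; rewrite mxE mul1r.
Qed.

Lemma det_Tmat : (\det (Tmat D p))%:~R
  = \det (block_mx (0 : 'M_1) (const_mx (-1)) (const_mx 1) legendre_mx).
Proof.
have E : (p.+1)./2 = (1 + (p.-1)./2)%N by have := prime_gt0 p_prime; case: (p).
rewrite -det_map_mx; apply: (det_cast (E := E)) => i j.
rewrite !mxE legendreE rmorphD rmorphM !rmorphXn /= -/d -!pmulrn.
case: splitP => i' /= ->; rewrite !mxE; case: splitP => j' /= ->; rewrite !mxE.
- by rewrite !ord1 expr0n mulr0 addr0 chi0.
- rewrite !ord1 expr0n add0r chiM // chi_nonresidue -[_%:R]/(rep j').
  by rewrite chi_sqr ?rep_neq0.
- by rewrite !ord1 expr0n mulr0 addr0 -[_%:R]/(rep i') chi_sqr ?rep_neq0.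
by [].
Qed.

Lemma det_expF_mx : \det (expF_mx 1) * \det (expF_mx d)
  = (g / 2%:R) ^+ (p.-1)./2 * (g * (\det (Tmat D p))%:~R).
Proof.
rewrite -det_mulmx expF_mxM detZ det_add_const det_legendre_mx add0r.
by rewrite det_Tmat.
Qed.

(** The value at 1 of (X^p - 1)/(X - 1). *)
Lemma prod_one_sub : \prod_(x : 'F_p | x != 0) (1 - e x) = p%:R.
Proof.
have E : 'X^p - 1 = \prod_(x : 'F_p) ('X - (e x)%:P).
  transitivity (\prod_(0 <= i < (Zp_trunc (pdiv p)).+2) ('X - (zeta ^+ i)%:P)).
    by rewrite Fp_cast // factor_Xn_sub_1.
  by rewrite big_mkord.
have X1 : 'X - 1%:P != 0 :> {poly algC} by rewrite polyXsubC_eq0.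
have PE : \sum_(i < p) 'X^i = \prod_(x : 'F_p | x != 0) ('X - (e x)%:P).
  by apply: (mulfI X1); rewrite -subrX1 E (bigD1 0) //= expF0.
have : (\sum_(i < p) 'X^i).[1] = p%:R :> algC.
  by rewrite horner_sum; under eq_bigr do rewrite hornerXn expr1n;
    rewrite sumr_const card_ord.
rewrite PE horner_prod => <-.
by apply: eq_bigr => x _; rewrite hornerXsubC.
Qed.

End Determinants.

(** * Galois action *)

Section MultiplicationPerm.
Variable p : nat.
Hypotheses (p_prime : prime p) (p_mod4 : (p = 1 %[mod 4])%N).
Let n := (p.-1)./2.

(** Multiplication by y^2 permutes the nonzero squares j^2.  On the Vandermonde
    determinant of these squares it acts by the sign of the permutation, and
    also by the product of the (y^2)^i for i < n, which is y^(n(n-1)) = (y^n)^(n-1),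
    that is (y/p), because n - 1 is odd. *)
Lemma sqr_perm_sign (y : 'F_p) : y != 0 ->
  exists s : {perm 'I_n},
    (forall j, rep (s j) ^+ 2 = y ^+ 2 * rep j ^+ 2)
    /\ (-1) ^+ s = chi y.
Proof.
move=> y0.
have cov (j : 'I_n) : exists k : 'I_n, rep k ^+ 2 == y ^+ 2 * rep j ^+ 2.
  have yj : y * rep j != 0 by rewrite mulf_neq0 ?rep_neq0.
  by have [k kE] := rep_sqr_cover p_prime p_mod4 yj; exists k; rewrite -exprMn kE.
have [f fE] := fin_all_exists cov.
have f_inj : injective f.
  move=> i j fij; apply: (rep_sqr_inj p_prime p_mod4).
  apply: (@mulfI _ (y ^+ 2)); first by rewrite sqrf_eq0.
  by rewrite -(eqP (fE i)) fij (eqP (fE j)).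
exists (perm f_inj); have sE j : rep (perm f_inj j) ^+ 2 = y ^+ 2 * rep j ^+ 2.
  by rewrite permE (eqP (fE j)).
split=> //; move: (perm f_inj) sE => s sE.
pose V := Vandermonde n (\row_(j < n) (rep j ^+ 2 : 'F_p)).
have V0 : \det V != 0.
  rewrite det_Vandermonde; apply/prodf_neq0 => i _; apply/prodf_neq0 => j ij.
  rewrite !mxE subr_eq0; apply: contraTN ij => /eqP /(rep_sqr_inj p_prime p_mod4) ->.
  by rewrite ltnn.
have VE : col_perm s V = diag_mx (\row_(i < n) (y ^+ 2) ^+ i) *m V.
  by apply/matrixP => i j; rewrite mul_diag_mx !mxE sE exprMn.
have signF : (-1) ^+ s = (chi y)%:~R :> 'F_p.
  apply: (mulfI V0); move/(congr1 determinant): VE.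
  rewrite col_permE !det_mulmx det_perm odd_permV => ->.
  rewrite mulrC; congr (_ * _); rewrite det_diag chi_euler //.
  under eq_bigr do rewrite mxE.
  rewrite prodrXr -exprM.
  have -> : (\sum_(i < n) i = 'C(n, 2))%N by rewrite -bin2_sum big_mkord.
  rewrite bin2 mul2n halfK oddM.
  have nev : ~~ odd n := half_not_odd p_prime p_mod4.
  have npos : (0 < n)%N := halfp_gt0 p_prime p_mod4.
  rewrite (negPf nev) subn0 exprM.
  have /eqP := fermat p_prime p_mod4 y0; rewrite -muln2 exprM -/n sqrf_eq1.
  case/orP => /eqP ->; rewrite ?expr1n //.
  by rewrite -signr_odd; move: nev npos; case: (n) => //= m; rewrite negbK => ->.
have ne : (1 : 'F_p) != -1 by rewrite -subr_eq0 opprK -mulr2n two_neq0.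
move: signF; case: (chi_cases y) => [/eqP|->|->]; first by rewrite (negPf y0).
  by case: (odd_perm s) => //= /eqP; rewrite expr1 eq_sym (negPf ne).
by case: (odd_perm s) => //= /eqP; rewrite expr0 (negPf ne).
Qed.

End MultiplicationPerm.

Section QuadraticField.
Variable p : nat.
Local Notation Qp := (in_Qsqrt p).
Local Notation q := (sqrtC p%:R : algC).

Lemma in_Qsqrt_rat r : Qp (ratr r).
Proof. by exists r, 0; rewrite rmorph0 mul0r addr0. Qed.

Lemma in_Qsqrt_sqrt : Qp q.
Proof. by exists 0, 1; rewrite rmorph0 rmorph1 mul1r add0r. Qed.

Lemma in_QsqrtD x y : Qp x -> Qp y -> Qp (x + y).
Proof.
move=> [r [s ->]] [r' [s' ->]]; exists (r + r'), (s + s').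
by rewrite !rmorphD /=; ring.
Qed.

Lemma in_QsqrtM x y : Qp x -> Qp y -> Qp (x * y).
Proof.
move=> [r [s ->]] [r' [s' ->]]; exists (r * r' + s * s' * p%:R), (r * s' + s * r').
rewrite !(rmorphD, rmorphM) /= rmorph_nat.
by move: (sqrtCK (p%:R : algC)); set r0 := sqrtC _ => <-; ring.
Qed.

Lemma in_Qsqrt_sum (I : Type) (r : seq I) (P : pred I) (F : I -> algC) :
  (forall i, Qp (F i)) -> Qp (\sum_(i <- r | P i) F i).
Proof.
move=> QF; apply: big_ind => //; last exact: in_QsqrtD.
by rewrite -(rmorph0 (@ratr algC)); apply: in_Qsqrt_rat.
Qed.

Lemma in_QsqrtX x m : Qp x -> Qp (x ^+ m).
Proof.
move=> Qx; elim: m => [|m IH]; last by rewrite exprS; apply: in_QsqrtM.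
by rewrite expr0 -(rmorph1 (@ratr algC)); apply: in_Qsqrt_rat.
Qed.

End QuadraticField.

Section GaloisAction.

Variable p : nat.
Hypotheses (p_prime : prime p) (p_mod4 : (p = 1 %[mod 4])%N).
Variable zeta : algC.
Hypothesis zeta_prim : p.-primitive_root zeta.
Variable d : 'F_p.
Hypothesis chid : chi d = -1.
Let n := (p.-1)./2.
Local Notation e := (expF zeta).
Local Notation g := (gauss_sum p zeta).

Lemma expF_aut (c : 'F_p) : c != 0 ->
  exists u : {rmorphism algC -> algC}, forall x : 'F_p, u (e x) = e (c * x).
Proof.
move=> c0.
have cop : coprime c p.
  rewrite coprime_sym prime_coprime // -natF_eq0 //.
  by rewrite natr_Zp.
have [u uE] := Qn_aut_exists cop; exists u => x.
rewrite uE; last first.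
  by rewrite /expF -exprM mulnC exprM (prim_expr_order zeta_prim) expr1n.
by rewrite -expFMn // natr_Zp mulrC.
Qed.

Lemma aut_quartic (u : {rmorphism algC -> algC}) (c c' : 'F_p) :
  (forall x : 'F_p, u (e x) = e (c * x)) ->
  u (quartic_sum zeta c') = quartic_sum zeta (c * c').
Proof.
move=> uE; rewrite /quartic_sum rmorph_sum; apply: eq_bigr => x _ /=.
by rewrite rmorphM rmorph_int uE mulrA.
Qed.

Lemma quartic_sqrM (c y : 'F_p) : y != 0 ->
  quartic_sum zeta (y ^+ 2 * c) = (chi y)%:~R * quartic_sum zeta c.
Proof.
move=> y0; rewrite /quartic_sum mulr_sumr [RHS](reindex_inj (mulfI y0)) /=.
apply: eq_bigr => x _; rewrite chiM // mulrA -intrM mulrA -chiM // -expr2.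
by rewrite chi_sqr // mul1r; congr (_ * e _); ring.
Qed.

Lemma aut_gauss (u : {rmorphism algC -> algC}) :
  (forall x : 'F_p, u (e x) = e (d * x)) -> u g = - g.
Proof.
move=> uE; have d0 : d != 0 by rewrite -chi_eq0 chid.
have := sum_expF_sqr p_prime p_mod4 zeta_prim chid d.
rewrite (negPf d0) addr0 chid mulN1r (sum_nonzeroE (fun x => e (x ^+ 2 * d))).
rewrite expr0n mul0r expF0 // => /addIr <-.
rewrite /gauss_sum rmorph_sum; apply: eq_bigr => x _ /=.
by rewrite uE mulrC.
Qed.

Definition in_Qzeta x := exists P : {poly rat}, x = (map_poly ratr P).[zeta].

Lemma in_QzetaM x y : in_Qzeta x -> in_Qzeta y -> in_Qzeta (x * y).
Proof. by move=> [P ->] [Q ->]; exists (P * Q); rewrite rmorphM hornerM. Qed.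

Lemma in_Qzeta_quartic (c : 'F_p) : in_Qzeta (quartic_sum zeta c).
Proof.
exists (\sum_(x : 'F_p) (chi x)%:~R *: 'X^((c * x ^+ 2)%R : 'F_p)).
rewrite rmorph_sum horner_sum; apply: eq_bigr => x _ /=.
by rewrite map_polyZ map_polyXn hornerZ hornerXn rmorph_int.
Qed.

Lemma gauss_sum_sqrtC : g = sqrtC p%:R \/ g = - sqrtC p%:R.
Proof.
have /eqP : g ^+ 2 = sqrtC p%:R ^+ 2 by rewrite sqrtCK gauss_sqr.
by rewrite eqf_sqr => /orP [] /eqP ->; [left | right].
Qed.

Lemma Qsqrt_gauss : in_Qsqrt p g.
Proof.
case: gauss_sum_sqrtC => ->; first exact: in_Qsqrt_sqrt.
rewrite -mulN1r -(rmorphN1 (@ratr algC)).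
by apply: in_QsqrtM; [apply: in_Qsqrt_rat | apply: in_Qsqrt_sqrt].
Qed.

(** Average x over the automorphisms zeta |-> zeta^(k^2), k = 1, ..., n: each
    power of zeta becomes a half sum of e, which lies in Q(g). *)
Lemma fixed_in_Qsqrt x : in_Qzeta x ->
  (forall (y : 'F_p) (u : {rmorphism algC -> algC}), y != 0 ->
     (forall t : 'F_p, u (e t) = e (y ^+ 2 * t)) -> u x = x) ->
  in_Qsqrt p x.
Proof.
move=> [P xP] fix_x.
have xE (k : 'I_n) : x = \sum_(i < size P) ratr P`_i * e (i%:R * rep k ^+ 2).
  have k20 : rep k ^+ 2 != 0 :> 'F_p by rewrite sqrf_eq0 rep_neq0.
  have [u uE] := expF_aut k20.
  rewrite -(fix_x _ _ (rep_neq0 p_prime p_mod4 k) uE) xP.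
  rewrite horner_coef size_map_poly rmorph_sum; apply: eq_bigr => i _ /=.
  rewrite coef_map rmorphM /= fmorph_rat -(expF_nat p_prime zeta_prim) uE.
  by rewrite mulrC [_ * i%:R]mulrC mulrC.
have n0 : n%:R != 0 :> algC.
  by rewrite pnatr_eq0 -lt0n (halfp_gt0 p_prime p_mod4).
have -> : x = n%:R^-1 * \sum_(k < n) x.
  by rewrite sumr_const card_ord -[x *+ n]mulr_natl mulKf.
rewrite -[n%:R^-1](_ : ratr n%:R^-1 = _); last by rewrite fmorphV rmorph_nat.
apply: in_QsqrtM; first exact: in_Qsqrt_rat.
rewrite (eq_bigr _ (fun k _ => xE k)) exchange_big /=.
apply: in_Qsqrt_sum => i; rewrite -mulr_sumr.
apply: in_QsqrtM; first exact: in_Qsqrt_rat.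
case: (eqVneq (i%:R : 'F_p) 0) => [->|i0].
  under eq_bigr do rewrite mul0r expF0 //.
  by rewrite sumr_const card_ord -(rmorph_nat (@ratr algC)); apply: in_Qsqrt_rat.
rewrite (half_sum_expF p_prime p_mod4 zeta_prim chid) //.
rewrite -(rmorph_int (@ratr algC)) -[2%:R](rmorph_nat (@ratr algC)) -fmorphV.
apply: in_QsqrtM; last exact: in_Qsqrt_rat.
rewrite -(rmorphN1 (@ratr algC)).
apply: in_QsqrtD; last exact: in_Qsqrt_rat.
by apply: in_QsqrtM; [apply: in_Qsqrt_rat | apply: Qsqrt_gauss].
Qed.

(** The matrix C with zeta replaced by zeta^c. *)
Definition Cmat_twist (c : 'F_p) : 'M[algC]_((p.-1)./2) :=
  \matrix_(j, k) ((1 - e (c * rep j ^+ 2 * rep k ^+ 2)) / (1 - e (c * rep j ^+ 2))).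

Lemma CmatE : Cmat p zeta = Cmat_twist 1.
Proof.
apply/matrixP => j k; rewrite !mxE !mul1r /rep -!natrX -natrM.
by rewrite !expF_nat.
Qed.

Lemma aut_det_Cmat (u : {rmorphism algC -> algC}) (c : 'F_p) :
  (forall x : 'F_p, u (e x) = e (c * x)) ->
  u (\det (Cmat p zeta)) = \det (Cmat_twist c).
Proof.
move=> uE; rewrite -det_map_mx; congr (\det _); apply/matrixP => j k.
rewrite CmatE !mxE rmorphM fmorphV !rmorphB rmorph1 /= !uE mul1r.
by rewrite mulrA.
Qed.

Lemma det_Cmat_twist_sqr (y : 'F_p) : y != 0 ->
  \det (Cmat_twist (y ^+ 2)) = (chi y)%:~R * \det (Cmat p zeta).
Proof.
move=> /(sqr_perm_sign p_prime p_mod4) [s [sE <-]].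
have -> : Cmat_twist (y ^+ 2) = row_perm s (Cmat p zeta).
  by apply/matrixP => j k; rewrite CmatE !mxE !mul1r sE.
by rewrite row_permE det_mulmx det_perm rmorph_sign.
Qed.

(** The divisions are exact: each entry is a geometric sum. *)
Lemma in_Qzeta_det_Cmat : in_Qzeta (\det (Cmat p zeta)).
Proof.
pose f : {rmorphism {poly rat} -> algC} := horner_eval zeta \o map_poly ratr.
pose A : 'M[{poly rat}]_((p.-1)./2) :=
  \matrix_(j, k) \sum_(i < k.+1 ^ 2) 'X^(j.+1 ^ 2 * i).
exists (\det A); rewrite -[RHS]/(f (\det A)) -det_map_mx.
congr (\det _); apply/matrixP => j k; rewrite !mxE rmorph_sum /=.
have z1 : zeta ^+ (j.+1 ^ 2) != 1.
  rewrite -(expF_nat p_prime zeta_prim) (expF_eq1 p_prime zeta_prim) natrX.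
  by rewrite sqrf_eq0 (rep_neq0 p_prime p_mod4 j).
have -> : \sum_(i < k.+1 ^ 2) f 'X^(j.+1 ^ 2 * i)
        = \sum_(i < k.+1 ^ 2) (zeta ^+ (j.+1 ^ 2)) ^+ i.
  apply: eq_bigr => i _.
  by rewrite /f /= /horner_eval map_polyXn hornerXn exprM.
rewrite exprM -opprB subrX1 -(opprB _ 1) invrN mulrNN mulrAC mulfV ?mul1r //.
by rewrite subr_eq0.
Qed.

End GaloisAction.

(** * Sums of two squares *)

Lemma int_parity (x : int) : (exists i, x = 2 * i) \/ (exists i, x = 2 * i + 1).
Proof.
have := divz_eq x 2; have := modz_ge0 x (isT : 2 != 0 :> int).
have := ltz_pmod x (isT : 0 < 2 :> int).
move=> h1 h2 h3.
have [m|m] : (x %% 2)%Z = 0 \/ (x %% 2)%Z = 1 by lia.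
- by left; exists (x %/ 2)%Z; lia.
by right; exists (x %/ 2)%Z; lia.
Qed.

Lemma odd_intP (x : int) : ~~ (2 %| x)%Z -> exists i, x = 2 * i + 1.
Proof.
by case: (int_parity x) => [[i ->]|//]; rewrite dvdz_mulr.
Qed.

(** p divides (a b' - a' b)(a b' + a' b) = p (a^2 - a'^2), hence one factor, say
    the first.  By Lagrange's identity
    (a b' - a' b)^2 + (a a' + b b')^2 = p^2, and the second square is not 0 as
    a a' + b b' is odd; so the first factor vanishes. *)
Lemma two_squares_unique (p : nat) (a b a' b' : int) : prime p -> odd p ->
  p%:Z = a ^+ 2 + b ^+ 2 -> p%:Z = a' ^+ 2 + b' ^+ 2 ->
  ~~ (2 %| a)%Z -> ~~ (2 %| a')%Z -> a ^+ 2 = a' ^+ 2.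
Proof.
move=> p_prime p_odd pE pE' /odd_intP [i aE] /odd_intP [i' aE'].
have p_gt0 : 0 < p%:Z by rewrite ltz_nat prime_gt0.
have [r rE] : exists r : int, p%:Z = 2 * r + 1.
  by exists (p./2)%:Z; rewrite -{1}(odd_double_half p) p_odd -muln2; lia.
have [j bE] : exists j, b = 2 * j.
  case: (int_parity b) => // -[j bE].
  have : 2 * r + 1 = 2 * (2 * i ^+ 2 + 2 * i + 2 * j ^+ 2 + 2 * j + 1).
    by rewrite -rE pE aE bE; ring.
  by lia.
have b2 : b ^+ 2 = p%:Z - a ^+ 2 by rewrite pE addrAC subrr add0r.
have b'2 : b' ^+ 2 = p%:Z - a' ^+ 2 by rewrite pE' addrAC subrr add0r.
have prodE : (a * b' - a' * b) * (a * b' + a' * b) = p%:Z * (a ^+ 2 - a' ^+ 2).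
  transitivity (a ^+ 2 * b' ^+ 2 - a' ^+ 2 * b ^+ 2); first by ring.
  by rewrite b2 b'2; ring.
(* applied to c = b' and to c = - b' *)
have key (c : int) : c ^+ 2 = p%:Z - a' ^+ 2 -> (p%:Z %| a * c - a' * b)%Z ->
    a * c - a' * b = 0.
  move=> c2 /dvdzP [k kE].
  have v0 : 0 < (a * a' + b * c) ^+ 2.
    rewrite lt_def sqr_ge0 andbT sqrf_eq0; apply/eqP.
    have -> : a * a' + b * c = 2 * (2 * i * i' + i + i' + j * c) + 1.
      by rewrite aE aE' bE; ring.
    by lia.
  have sumE : (a * c - a' * b) ^+ 2 + (a * a' + b * c) ^+ 2 = p%:Z ^+ 2.
    transitivity ((a ^+ 2 + b ^+ 2) * (a' ^+ 2 + c ^+ 2)); first by ring.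
    by rewrite c2 -pE; ring.
  have k1 : k ^+ 2 < 1.
    have p2 : 0 < p%:Z ^+ 2 by rewrite exprn_gt0.
    rewrite -(ltr_pM2r p2) mul1r -exprMn -kE -sumE.
    by rewrite ltrDl.
  have /eqP : k ^+ 2 = 0 by have := sqr_ge0 k; lia.
  by rewrite sqrf_eq0 kE => /eqP ->; rewrite mul0r.
have p0 : p%:Z != 0 by rewrite gt_eqF.
have fin : (a * b' - a' * b) * (a * b' + a' * b) = 0 -> a ^+ 2 = a' ^+ 2.
  move/eqP; rewrite prodE mulf_eq0 (negPf p0) subr_eq0 /=.
  by move/eqP.
apply: fin; apply/eqP; rewrite mulf_eq0.
have : (p%:Z %| (a * b' - a' * b) * (a * b' + a' * b))%Z.
  by rewrite prodE dvdz_mulr.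
rewrite dvdzE abszM Euclid_dvdM // => /orP [] pd; apply/orP; [left|right].
  by rewrite key // dvdzE.
rewrite -oppr_eq0 opprD -mulrN; apply/eqP/key; rewrite ?sqrrN //.
by rewrite mulrN -opprD dvdzE abszN.
Qed.

Lemma sum_sign_even m (f : 'I_m -> int) :
  (forall i, f i = 1 \/ f i = -1) -> ~~ odd m -> (2 %| \sum_i f i)%Z.
Proof.
move=> f1 mev.
have -> : \sum_i f i = \sum_i (f i - 1) + m%:Z.
  by rewrite sumrB sumr_const card_ord natz subrK.
apply: rpredD; last by rewrite dvdzE /= dvdn2.
by apply: rpred_sum => i _; case: (f1 i) => ->.
Qed.

(** * Comparison with the square root w *)

Section Assembly.

Variable p : nat.
Hypotheses (p_prime : prime p) (p_mod4 : (p = 1 %[mod 4])%N).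
Variable zeta : algC.
Hypothesis zeta_prim : p.-primitive_root zeta.
Variable D : int.
Hypothesis D_nonres : quadratic_nonresidue p D.
Let n := (p.-1)./2.
Let d : 'F_p := D%:~R.
Let chi_d : chi d = -1 := chi_nonresidue p_prime D_nonres.
Local Notation e := (expF zeta).
Local Notation g := (gauss_sum p zeta).

(** The half of jacobsthal 1 d is a sum of n signs, so it is even; therefore the
    half of the other one is the odd number of the representation of p, up to
    sign. *)
Lemma jacobsthal_sqr (a b : int) : ~~ (2 %| a)%Z -> p%:Z = a ^+ 2 + b ^+ 2 ->
  jacobsthal (1 : 'F_p) 1 ^+ 2 = 4 * a ^+ 2.
Proof.
move=> a_odd pE.
have J := jacobsthal_two_squares p_prime p_mod4 zeta_prim chi_d.
have d0 : d != 0 by rewrite -chi_eq0 chi_d.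
move: J; rewrite !(jacobsthal_half p_prime p_mod4).
set a' := \sum_k _; set b' := \sum_k _ => J.
have pE' : p%:Z = a' ^+ 2 + b' ^+ 2 by lia.
have p_odd : odd p by rewrite (p_half p_prime p_mod4) /= odd_double.
have b'_even : (2 %| b')%Z.
  apply: sum_sign_even => [k|]; last exact: half_not_odd p_prime p_mod4.
  have z0 : 1 + d * rep k ^+ 2 != 0.
    rewrite -(expr1n _ 2); apply: (add_nonsqr_neq0 p_prime p_mod4 chi_d).
    by rewrite oner_eq0.
  rewrite -chiM //; case: (chi_cases (rep k * (1 + d * rep k ^+ 2))).
  - by move/eqP; rewrite mulf_eq0 (negPf z0) (negPf (rep_neq0 _ _ _)).
  - by left.
  by right.
have a'_odd : ~~ (2 %| a')%Z.
  apply/negP => a'_even; have : (2 %| p%:Z)%Z.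
    by rewrite pE'; apply: rpredD; rewrite expr2 dvdz_mulr.
  by rewrite dvdzE /= dvdn2 p_odd.
rewrite (two_squares_unique p_prime p_odd pE pE' a_odd a'_odd).
by ring.
Qed.

Lemma sqrt_quartic (a b : int) (w : algC) :
  ~~ (2 %| a)%Z -> p%:Z = a ^+ 2 + b ^+ 2 ->
  w ^+ 2 = (legendre 2 p)%:~R * 2 * p%:R + 2 * a%:~R * sqrtC p%:R ->
  exists c : 'F_p, w = quartic_sum zeta c \/ w = - quartic_sum zeta c.
Proof.
move=> a_odd pE w2.
suff [c cE] : exists c : 'F_p, w ^+ 2 = quartic_sum zeta c ^+ 2.
  by exists c; move/eqP: cE; rewrite eqf_sqr => /orP [] /eqP; [left | right].
have J2 : (g * (jacobsthal (1 : 'F_p) 1)%:~R) ^+ 2 = (2 * a%:~R * sqrtC p%:R) ^+ 2.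
  rewrite [LHS]exprMn gauss_sqr // -rmorphXn /= (jacobsthal_sqr a_odd pE).
  by rewrite [RHS]exprMn sqrtCK rmorphM rmorphXn /=; ring.
have legE : (legendre 2 p)%:~R * 2 * p%:R
    = p%:R * (chi (2%:R : 'F_p) *+ 2)%:~R :> algC.
  rewrite legendreE // (_ : 2%:~R = 2%:R :> 'F_p) //.
  by rewrite rmorphMn /=; ring.
move/eqP: J2; rewrite eqf_sqr => /orP [] /eqP gJ.
  exists 1; rewrite (quartic1_sqr p_prime p_mod4 zeta_prim chi_d).
  by rewrite w2 gJ legE addrC.
exists d; rewrite (quarticd_sqr p_prime p_mod4 zeta_prim chi_d).
by rewrite w2 gJ legE addrC opprK.
Qed.

Lemma det_Cmat_twist (c : 'F_p) : c != 0 ->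
  \det (Cmat_twist zeta c) * \prod_(j : 'I_n) (1 - e (c * rep j ^+ 2))
    = \det (expF_mx zeta c).
Proof.
move=> c0.
(* the denominators, which scale the rows *)
pose v : 'rV[algC]_n := \row_j (1 - e (c * rep j ^+ 2)).
have -> : \prod_(j : 'I_n) (1 - e (c * rep j ^+ 2)) = \det (diag_mx v).
  by rewrite det_diag; apply: eq_bigr => j _; rewrite mxE.
rewrite mulrC -det_mulmx; congr (\det _); apply/matrixP => j k.
rewrite mul_diag_mx !mxE mulrC divfK; first by congr (1 - e _); ring.
rewrite subr_eq0 eq_sym (expF_eq1 p_prime zeta_prim).
by apply: mulf_neq0 => //; rewrite sqrf_eq0 rep_neq0.
Qed.

Lemma det_Cmat_conj :
  \det (Cmat p zeta) * \det (Cmat_twist zeta d) * p%:R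
    = (g / 2%:R) ^+ n * (g * (\det (Tmat D p))%:~R).
Proof.
have d0 : d != 0 by rewrite -chi_eq0 chi_d.
rewrite -(det_expF_mx p_prime p_mod4 zeta_prim D_nonres).
rewrite -(det_Cmat_twist (oner_neq0 _)) -(det_Cmat_twist d0).
rewrite CmatE // -(prod_one_sub p_prime zeta_prim).
rewrite (@big_nonzero_classes _ p_prime p_mod4 _ _ _ d _ chi_d) /=.
under [X in _ = _ * X * _]eq_bigr do rewrite mul1r.
by ring.
Qed.

Lemma Qsqrt_det_Cmat (c : 'F_p) :
  in_Qsqrt p (\det (Cmat p zeta) * quartic_sum zeta c).
Proof.
apply: (fixed_in_Qsqrt p_prime p_mod4 zeta_prim chi_d).
  by apply: in_QzetaM; [apply: in_Qzeta_det_Cmat | apply: in_Qzeta_quartic].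
move=> y u y0 uE; rewrite rmorphM (aut_det_Cmat p_prime zeta_prim uE).
rewrite (aut_quartic _ uE) (det_Cmat_twist_sqr p_prime p_mod4 zeta_prim y0).
rewrite (quartic_sqrM p_prime p_mod4 _ _ y0) mulrACA -intrM -chiM // -expr2.
by rewrite chi_sqr // mul1r.
Qed.

End Assembly.

(** E * u E is the norm of E.  It is rational and an algebraic integer, and so
    is its inverse. *)
Lemma norm_unit (p : nat) (u : {rmorphism algC -> algC}) (E : algC) :
  u (sqrtC p%:R) = - sqrtC p%:R -> OQsqrt_unit p E -> (E * u E) ^+ 2 = 1.
Proof.
move=> uq [E0 [[QE AE] [QE' AE']]].
have norm_int x : in_Qsqrt p x -> x \in Aint -> x * u x \in Num.int.
  move=> [r [s xE]] Ax; apply: Cint_rat_Aint; last by rewrite rpredM ?Aint_aut.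
  have -> : x * u x = ratr (r ^+ 2 - s ^+ 2 * p%:R).
    have -> : u x = ratr r - ratr s * sqrtC p%:R.
      by rewrite xE rmorphD [u (_ * sqrtC _)]rmorphM /= !fmorph_rat uq mulrN.
    rewrite xE rmorphB (rmorphM _ (s ^+ 2)) !rmorphXn /= rmorph_nat.
    by move: (sqrtCK (p%:R : algC)); set q := sqrtC _ => <-; ring.
  exact: Crat_rat.
have /intrP [i iE] := norm_int _ QE AE.
have /intrP [j jE] := norm_int _ QE' AE'.
have ij : i * j = 1.
  apply: (@intr_inj algC); rewrite rmorphM /= -iE -jE fmorphV.
  by rewrite mulrACA !mulfV ?fmorph_eq0 // mulr1.
rewrite iE -rmorphXn /=; suff -> : i ^+ 2 = 1 by [].
have : (`|i| * `|j| = 1)%N by rewrite -abszM ij.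
move/eqP; rewrite muln_eq1 => /andP [/eqP i1 _].
by move: i1; case: (i) => [[|[]]|[]].
Qed.

Theorem theorem2 (p : nat) (p_prime : prime p) (p_mod4 : (p = 1 %[mod 4])%N)
  (zeta : algC) (zeta_prim : p.-primitive_root zeta)
  (a b : int) (a_odd : ~~ (2 %| a)%Z) (p_eq : p%:Z = a ^+ 2 + b ^+ 2)
  (D : int) (D_nonres : quadratic_nonresidue p D)
  (h : nat) (h_class : class_number p h)
  (eps : algC) (eps_fund : fundamental_unit p eps)
  (w : algC)
  (w_root : w ^+ 2 = (legendre 2 p)%:~R * 2 * p%:R
                     + 2 * a%:~R * sqrtC p%:R) :
  exists alpha beta : rat,
    \det (Cmat p zeta)
      = eps ^+ h / sqrtC p%:R * (ratr alpha + ratr beta * sqrtC p%:R) * w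
    /\ exists s : bool,
         (-1) ^+ s * 2 ^+ (p.+1)./2 * b%:~R
           * (alpha ^+ 2 - p%:R * beta ^+ 2)
         = p%:R ^+ (p.-1 %/ 4) * (\det (Tmat D p))%:~R.
Proof.
have chi_d := chi_nonresidue p_prime D_nonres; set d : 'F_p := D%:~R in chi_d.
have d0 : d != 0 by rewrite -chi_eq0 chi_d.
have p0 : p%:R != 0 :> algC by rewrite pnatr_eq0 -lt0n prime_gt0.
have [u uE] := expF_aut p_prime zeta_prim d0.
pose q : algC := sqrtC p%:R; have q2 : q ^+ 2 = p%:R by rewrite sqrtCK.
have q0 : q != 0 by rewrite -sqrf_eq0 q2.
have uq : u q = - q.
  have := aut_gauss p_prime p_mod4 zeta_prim chi_d uE.
  case: (gauss_sum_sqrtC p_prime p_mod4 zeta_prim) => -> //.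
  by rewrite rmorphN => /oppr_inj.
have [eps_unit _ _] := eps_fund.
have eps_norm := norm_unit uq eps_unit.
have [eps0 [[Qeps _] [Qeps' _]]] := eps_unit.
pose X := \det (Cmat p zeta).
have XX : (X * u X) ^+ 2 * 4 ^+ (p.-1)./2
          = p%:R ^+ (p.-1)./2 / p%:R * (\det (Tmat D p))%:~R ^+ 2.
  have := det_Cmat_conj p_prime p_mod4 zeta_prim D_nonres.
  rewrite -(aut_det_Cmat p_prime zeta_prim uE) -/X => E.
  have {}E : ((X * u X) * p%:R) ^+ 2
      = ((gauss_sum p zeta / 2) ^+ (p.-1)./2
         * (gauss_sum p zeta * (\det (Tmat D p))%:~R)) ^+ 2.
    by rewrite E.
  move: E; rewrite !exprMn -!exprM ![(_ * 2)%N]mulnC !exprM.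
  rewrite (gauss_sqr p_prime p_mod4 zeta_prim) => E.
  have f2 m : 2 ^+ m != 0 :> algC by rewrite expf_neq0 // pnatr_eq0.
  apply: (mulIf (expf_neq0 2 p0)); rewrite mulrAC E.
  have -> : 4 = 2 ^+ 2 :> algC by rewrite -natrX.
  rewrite exprVn.
  have : 2 ^+ 2 ^+ (p.-1)./2 != 0 :> algC by rewrite -exprM.
  rewrite exprVn; set A := 2 ^+ 2 ^+ _; set B := p%:R ^+ (p.-1)./2 => A0.
  by field; rewrite A0 p0.
have b0 : b != 0.
  apply/eqP => b0; have pE : p = (`|a| * `|a|)%N.
    apply/eqP; rewrite -eqz_nat p_eq b0 expr0n addr0 PoszM abszE -normrM -expr2.
    by rewrite ger0_norm ?sqr_ge0.
  have /primeP [p_gt1 p_div] := p_prime.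
  have ap : (`|a| %| p)%N by rewrite pE dvdn_mulr.
  move: pE (p_div _ ap); case: `|a|%N => [|[|m]] pE /=; rewrite ?pE // in p_gt1 *.
  by rewrite -[X in X == _]muln1 eqn_pmul2l.
(* the conjugate of w ^+ 2 *)
pose z : algC := (legendre 2 p)%:~R * 2 * p%:R - 2 * a%:~R * q.
have uw2 : u w ^+ 2 = z.
  rewrite -rmorphXn w_root rmorphD !rmorphM /= uq !rmorph_int !rmorph_nat.
  by rewrite mulrN.
have leg2 : (legendre 2 p)%:~R ^+ 2 = 1 :> algC.
  rewrite legendreE // (_ : 2%:~R = 2%:R :> 'F_p) //.
  have := two_neq0 p_prime p_mod4; case: (chi_cases (2%:R : 'F_p)) => [->|->|->].
  - by rewrite eqxx.
  - by rewrite expr1n.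
  by rewrite sqrrN expr1n.
have w_norm : w ^+ 2 * z = 4 * p%:R * b%:~R ^+ 2.
  have pE : p%:R = a%:~R ^+ 2 + b%:~R ^+ 2 :> algC.
    by rewrite -!rmorphXn -rmorphD -p_eq.
  transitivity (4 * (legendre 2 p)%:~R ^+ 2 * p%:R ^+ 2 - 4 * a%:~R ^+ 2 * q ^+ 2).
    by rewrite w_root -/q /z; ring.
  have -> : b%:~R ^+ 2 = p%:R - a%:~R ^+ 2 :> algC by rewrite pE addrAC subrr add0r.
  by rewrite leg2 q2; ring.
have [c wE] := sqrt_quartic p_prime p_mod4 zeta_prim D_nonres a_odd p_eq w_root.
have Qneg x : in_Qsqrt p x -> in_Qsqrt p (- x).
  move=> Qx; rewrite -mulN1r -(rmorphN1 (@ratr algC)).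
  by apply: in_QsqrtM => //; apply: in_Qsqrt_rat.
have QXw : in_Qsqrt p (X * w).
  have QXc := Qsqrt_det_Cmat p_prime p_mod4 zeta_prim D_nonres c.
  by case: wE => ->; rewrite ?mulrN //; apply: Qneg.
have Qint (x : int) : in_Qsqrt p x%:~R.
  by rewrite -(rmorph_int (@ratr algC)); apply: in_Qsqrt_rat.
have Qz : in_Qsqrt p z.
  have -> : z = (legendre 2 p * 2 * p%:Z)%:~R + (- (2 * a))%:~R * q.
    by rewrite /z rmorphN !rmorphM /= -!pmulrn mulNr.
  by apply: in_QsqrtD => //; apply: in_QsqrtM => //; apply: in_Qsqrt_sqrt.
(* w^-1 is w * z / (w ^+ 2 * z), where w ^+ 2 * z is rational *)
pose M : rat := (4 * p%:R * b%:~R ^+ 2)^-1.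
have ME : ratr M = (4 * p%:R * b%:~R ^+ 2)^-1 :> algC.
  by rewrite fmorphV 2!rmorphM rmorphXn /= !rmorph_nat rmorph_int.
have b0C : b%:~R != 0 :> algC by rewrite intr_eq0.
have [alpha [beta yE]] : in_Qsqrt p (X * w * q * z * ratr M * eps^-1 ^+ h).
  apply: in_QsqrtM; last exact: in_QsqrtX.
  apply: in_QsqrtM; last exact: in_Qsqrt_rat.
  by do 2 apply: in_QsqrtM => //; apply: in_Qsqrt_sqrt.
have epsh0 : eps ^+ h != 0 by rewrite expf_neq0.
have XE : X = eps ^+ h / q * (ratr alpha + ratr beta * q) * w.
  rewrite -yE ME exprVn.
  have -> : eps ^+ h / q * (X * w * q * z * (4 * p%:R * b%:~R ^+ 2)^-1 / eps ^+ h) * w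
    = (eps ^+ h / eps ^+ h) * (q / q) * X * (w ^+ 2 * z) / (4 * p%:R * b%:~R ^+ 2).
    by ring.
  rewrite w_norm !mulfV // !mul1r mulfK //.
  by rewrite !mulf_neq0 ?expf_neq0 // pnatr_eq0.
exists alpha, beta; split; first exact: XE.
pose N := alpha ^+ 2 - p%:R * beta ^+ 2.
have NE : ratr N = (ratr alpha + ratr beta * q) * (ratr alpha - ratr beta * q).
  rewrite /N rmorphB (rmorphM _ p%:R) !rmorphXn /= rmorph_nat -q2.
  by ring.
have uXE : u X = u eps ^+ h / (- q) * (ratr alpha - ratr beta * q) * u w.
  rewrite XE !rmorphM rmorphD [u (_ * q)]rmorphM fmorphV rmorphXn /= uq.
  by rewrite !fmorph_rat mulrN.
have XXN : (X * u X) ^+ 2 = ratr N ^+ 2 * 4 * b%:~R ^+ 2 / p%:R.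
  rewrite uXE {1}XE NE.
  transitivity (((eps * u eps) ^+ 2) ^+ h * ratr N ^+ 2
                * (w ^+ 2 * u w ^+ 2) / (q ^+ 2) ^+ 2).
    by rewrite NE exprAC !exprMn; field.
  rewrite eps_norm expr1n uw2 w_norm q2 NE.
  by field.
have pow2 : 2 ^+ (p.+1)./2 = 2 * 2 ^+ (p.-1)./2 :> rat.
  by rewrite -exprS [in LHS](p_half p_prime p_mod4) -doubleS doubleK.
have quarter : (p.-1)./2 = (p.-1 %/ 4 * 2)%N.
  by rewrite -divn2; move: p_mod4; lia.
(* All the signs that are not determined disappear in the squares. *)
have sqr_eq : (2 ^+ (p.+1)./2 * b%:~R * N) ^+ 2
            = (p%:R ^+ (p.-1 %/ 4) * (\det (Tmat D p))%:~R) ^+ 2.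
  rewrite pow2; apply: (fmorph_inj (@ratr algC)).
  rewrite !rmorphXn /= !(rmorphM (@ratr algC)) /= !rmorphXn /= !rmorph_nat !rmorph_int.
  have E : (X * u X) ^+ 2 * 4 ^+ (p.-1)./2 * p%:R
      = p%:R ^+ (p.-1)./2 * (\det (Tmat D p))%:~R ^+ 2.
    by rewrite XX; field.
  rewrite [RHS]exprMn -exprM -quarter -E XXN.
  have -> : 4 ^+ (p.-1)./2 = (2 ^+ (p.-1)./2) ^+ 2 :> algC.
    by rewrite [RHS]exprAC; congr (_ ^+ _); rewrite -natrX.
  by field.
move/eqP: sqr_eq; rewrite eqf_sqr => /orP [] /eqP E; [exists false | exists true].
  by rewrite mul1r.
by rewrite -/N expr1 !mulN1r !mulNr E opprK.
Qed.
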